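(* Let $L=(h_1,\ldots,h_n)$ be a closed chain of revolute joints of mobility one with $h_{i+1}\neq\pm h_i$ for all $i$ (cyclically). Let $\beta\in\mathrm{NC}(K)$ be a bond with $\nu(\beta)=(t_1,\ldots,t_n)$. Then there exist indices $i,j\in\{1,\ldots,n\}$, $i<j$, such that $t_i^2+1=t_j^2+1=0$.
   Context: Let $\mathbb{DH}$ be the algebra of dual quaternions (quaternions with coefficients in $\mathbb{R}+\epsilon\mathbb{R}$, $\epsilon^2=0$). A revolute joint is represented by a dual quaternion $h$ with zero scalar part and $h\overline h=-h^2=1$ (overline is quaternion conjugation). A closed chain is a cyclic sequence $L=(h_1,\ldots,h_n)$ of such elements, with indices read modulo $n$. Its configuration set $K$ is the set of $(t_1,\ldots,t_n)\in(\mathbb{P}^1_{\mathbb{R}})^n$ with $$(t_1-h_1)(t_2-h_2)\cdots(t_n-h_n)\in\mathbb{R}\setminus\{0\}.$$ For $t_k=\infty$ the factor $t_k-h_k$ is read as $1$; i.e. with homogeneous coordinates $(t_k:s_k)$ the factor is $t_k-s_kh_k$ up to scaling, and $t_k^2+1$ is read as $t_k^2+s_k^2$. Mobility one means $\dim K=1$. $K_{\mathbb{C}}\subset(\mathbb{P}^1_{\mathbb{C}})^n$ is the Zariski closure of $K$ and $\nu\colon\mathrm{NC}(K)\to K_{\mathbb{C}}$ is the normalization of the algebraic curve $K_{\mathbb{C}}$. Put $$B=\{(t_1,\ldots,t_n)\in K_{\mathbb{C}}\mid (t_1-h_1)(t_2-h_2)\cdots(t_n-h_n)=0\},$$ the product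 being taken in $\mathbb{C}\otimes_{\mathbb{R}}\mathbb{DH}$ (the complex imaginary unit is distinct from the quaternion units). A point $\beta\in\mathrm{NC}(K)$ is called a bond if $\nu(\beta)\in B$. *)

(* Defs.v *)
From HB Require Import structures.
From mathcomp Require Import all_boot all_order all_algebra.
From mathcomp Require Import boolp classical_sets functions reals.
From mathcomp Require Import mpoly complex ring.

Set Implicit Arguments.
Unset Strict Implicit.
Unset Printing Implicit Defensive.

Import GRing.Theory.
Local Open Scope classical_set_scope.
Local Open Scope ring_scope.

(* [(a, b) : dual A] is a + eps b, with eps^2 = 0. *)
Definition dual (A : Type) : Type := (A * A)%type.

Section DualNumbers.
Variable A : comNzRingType.

HB.instance Definition _ := GRing.Zmodule.copy (dual A) (A * A)%type.

Definition dual_one : dual A := (1, 0).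
Definition dual_mul (x y : dual A) : dual A :=
  (x.1 * y.1, x.1 * y.2 + x.2 * y.1).

Fact dual_mulA : associative dual_mul.
Proof. by move=> [a b] [c d] [e f]; congr pair => /=; ring. Qed.
Fact dual_mulC : commutative dual_mul.
Proof. by move=> [a b] [c d]; congr pair => /=; ring. Qed.
Fact dual_mul1 : left_id dual_one dual_mul.
Proof. by move=> [a b]; congr pair => /=; ring. Qed.
Fact dual_mulDl : left_distributive dual_mul +%R.
Proof. by move=> [a b] [c d] [e f]; congr pair => /=; ring. Qed.
Fact dual_one_neq0 : dual_one != 0.
Proof. by apply/eqP => -[/eqP]; rewrite oner_eq0. Qed.

HB.instance Definition _ := GRing.Zmodule_isComNzRing.Build (dual A)
  dual_mulA dual_mulC dual_mul1 dual_mulDl dual_one_neq0.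

End DualNumbers.

(* [Quat a b c d] is a + b i + c j + d k. *)
Record quat (A : Type) : Type := Quat { qre : A; qi : A; qj : A; qk : A }.

Section Quaternions.

Definition quat_prod (A : Type) (x : quat A) := (qre x, qi x, qj x, qk x).
Definition prod_quat (A : Type) (x : A * A * A * A) :=
  Quat x.1.1.1 x.1.1.2 x.1.2 x.2.
Fact quat_prodK (A : Type) : cancel (@quat_prod A) (@prod_quat A).
Proof. by case. Qed.

HB.instance Definition _ (A : eqType) :=
  Equality.copy (quat A) (can_type (@quat_prodK A)).
HB.instance Definition _ (A : choiceType) :=
  Choice.copy (quat A) (can_type (@quat_prodK A)).

Variable A : comNzRingType.

Definition quat_zero : quat A := Quat 0 0 0 0.
Definition quat_opp (x : quat A) := Quat (- qre x) (- qi x) (- qj x) (- qk x).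
Definition quat_add (x y : quat A) :=
  Quat (qre x + qre y) (qi x + qi y) (qj x + qj y) (qk x + qk y).

Fact quat_addA : associative quat_add.
Proof. by move=> [????] [????] [????]; rewrite /quat_add /= !addrA. Qed.
Fact quat_addC : commutative quat_add.
Proof. by move=> [????] [????]; congr Quat; rewrite /= addrC. Qed.
Fact quat_add0 : left_id quat_zero quat_add.
Proof. by move=> [????]; rewrite /quat_add /= !add0r. Qed.
Fact quat_addN : left_inverse quat_zero quat_opp quat_add.
Proof. by move=> [????]; rewrite /quat_add /= !addNr. Qed.

HB.instance Definition _ := GRing.isZmodule.Build (quat A)
  quat_addA quat_addC quat_add0 quat_addN.

Definition quat_one : quat A := Quat 1 0 0 0.
Definition quat_mul (x y : quat A) :=
  let: Quat a b c d := x in let: Quat a' b' c' d' := y in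
  Quat (a * a' - b * b' - c * c' - d * d')
       (a * b' + b * a' + c * d' - d * c')
       (a * c' - b * d' + c * a' + d * b')
       (a * d' + b * c' - c * b' + d * a').

Fact quat_mulA : associative quat_mul.
Proof. by move=> [????] [????] [????]; congr Quat; ring. Qed.
Fact quat_mul1l : left_id quat_one quat_mul.
Proof. by move=> [????]; congr Quat; ring. Qed.
Fact quat_mul1r : right_id quat_one quat_mul.
Proof. by move=> [????]; congr Quat; ring. Qed.
Fact quat_mulDl : left_distributive quat_mul +%R.
Proof. by move=> [????] [????] [????]; congr Quat => /=; ring. Qed.
Fact quat_mulDr : right_distributive quat_mul +%R.
Proof. by move=> [????] [????] [????]; congr Quat => /=; ring. Qed.
Fact quat_one_neq0 : quat_one != 0.
Proof. by apply/eqP => -[/eqP]; rewrite oner_eq0. Qed.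

HB.instance Definition _ := GRing.Zmodule_isNzRing.Build (quat A)
  quat_mulA quat_mul1l quat_mul1r quat_mulDl quat_mulDr quat_one_neq0.

Definition quat_conj (x : quat A) : quat A :=
  Quat (qre x) (- qi x) (- qj x) (- qk x).

End Quaternions.

(* [dualquat R] is the algebra DH, and [dualquat R[i]] is C (x)_R DH: its
   scalars are the elements of R[i], so that 'i is central and is not one of the
   quaternion units. *)
Notation dualquat F := (quat (dual F)).

Definition dq_const (F : nzRingType) (c : F) : dualquat F :=
  Quat (c, 0) (0, 0) (0, 0) (0, 0).

Definition dual_map (F G : Type) (u : F -> G) (x : dual F) : dual G :=
  (u x.1, u x.2).

Definition dq_map (F G : Type) (u : F -> G) (x : dualquat F) : dualquat G :=
  Quat (dual_map u (qre x)) (dual_map u (qi x))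
       (dual_map u (qj x)) (dual_map u (qk x)).

Definition revolute (F : comNzRingType) (h : dualquat F) : Prop :=
  qre h = 0 /\ h * quat_conj h = 1.

(* For elements with zero scalar part, the condition h * conj h = 1 is the same
   as - h^2 = 1. *)
Lemma revolute_sqr (F : comNzRingType) (h : dualquat F) :
  revolute h -> - h ^+ 2 = 1.
Proof.
case: h => a b c d [/= -> <-]; rewrite expr2.
by congr Quat => /=; ring.
Qed.

(* The projective line, [None] being the point at infinity. *)
Definition P1 (F : Type) : Type := option F.

(* Homogeneous coordinates (t : s), normalized to (t : 1) and (1 : 0). *)
Definition hcoord (F : nzRingType) (x : P1 F) : F * F :=
  if x is Some t then (t, 1) else (1, 0).

(* t^2 + 1, read as t^2 + s^2. *)
Definition sqr_add1 (F : nzRingType) (x : P1 F) : F :=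
  (hcoord x).1 ^+ 2 + (hcoord x).2 ^+ 2.

(* t - h, read as t - s h. *)
Definition joint_factor (F : comNzRingType) (h : dualquat F) (x : P1 F) :
    dualquat F :=
  dq_const (hcoord x).1 - dq_const (hcoord x).2 * h.

Definition chain_prod (F : comNzRingType) (n : nat) (h : 'I_n -> dualquat F)
    (t : 'I_n -> P1 F) : dualquat F :=
  \prod_(k < n) joint_factor (h k) (t k).

Section Zariski.
Variables (F : fieldType) (n : nat).

Notation pt := ('I_n -> P1 F).

(* Forms on (P^1)^n are polynomials in the variables t_i = 'X_(lshift n i) and
   s_i = 'X_(rshift n i), homogeneous of degree d i in (t_i, s_i) for each i. *)
Definition multihomog (d : 'I_n -> nat) (f : {mpoly F[n + n]}) : Prop :=
  forall m, m \in msupp f -> forall i, (m (lshift n i) + m (rshift n i))%N = d i.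

Definition heval (f : {mpoly F[n + n]}) (x : pt) : F :=
  f.@[fun k => match fintype.split k with
               | inl i => (hcoord (x i)).1
               | inr i => (hcoord (x i)).2
               end].

Definition zclosed (Z : set pt) : Prop :=
  exists P : set {mpoly F[n + n]},
    (forall f, P f -> exists d, multihomog d f) /\
    Z = [set x | forall f, P f -> heval f x = 0].

Definition zclosure (S : set pt) : set pt :=
  \bigcap_(Z in [set Z | zclosed Z /\ S `<=` Z]) Z.

Definition zirreducible (A : set pt) : Prop :=
  A !=set0 /\
  forall Z1 Z2, zclosed Z1 -> zclosed Z2 ->
    A `<=` Z1 `|` Z2 -> A `<=` Z1 \/ A `<=` Z2.

(* There is a chain c 0 < ... < c r of irreducible closed subsets of the
   subspace S. *)
Definition zdim_ge (S : set pt) (r : nat) : Prop :=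
  exists c : nat -> set pt,
    (forall k, (k <= r)%N ->
       zirreducible (c k) /\ exists2 Z, zclosed Z & c k = S `&` Z) /\
    (forall k, (k < r)%N -> c k `<` c k.+1).

(* Krull dimension for the Zariski topology. *)
Definition zdim (S : set pt) (r : nat) : Prop := zdim_ge S r /\ ~ zdim_ge S r.+1.

Definition irr_component (X Z : set pt) : Prop :=
  [/\ Z `<=` X, zirreducible Z &
      forall Z', Z' `<=` X -> zirreducible Z' -> Z `<=` Z' -> Z' = Z].

(* The function field of an irreducible Z is encoded by total functions pt -> F
   taken modulo equality on a nonempty open subset of Z; the values off such a
   subset are irrelevant. Subrings and ideals of the function field are encoded
   by the sets of all functions which represent their elements. *)
Definition gen_eq (Z : set pt) (phi psi : pt -> F) : Prop :=
  exists Y, [/\ zclosed Y, ~ Z `<=` Y & forall x, Z x -> ~ Y x -> phi x = psi x].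

Definition hfrac (f g : {mpoly F[n + n]}) : pt -> F :=
  fun x => heval f x / heval g x.

Definition function_field (Z : set pt) : set (pt -> F) :=
  [set phi | exists d f g, [/\ multihomog d f, multihomog d g,
     exists2 x, Z x & heval g x != 0 & gen_eq Z phi (hfrac f g)]].

(* The local ring O_{Z,p}. *)
Definition local_ring (Z : set pt) (p : pt) : set (pt -> F) :=
  [set phi | exists d f g, [/\ multihomog d f, multihomog d g,
     heval g p != 0 & gen_eq Z phi (hfrac f g)]].

(* The integral closure of O_{Z,p} in the function field of Z. *)
Definition integral_closure (Z : set pt) (p : pt) : set (pt -> F) :=
  [set phi | function_field Z phi /\
     exists (r : nat) (a : 'I_r -> pt -> F),
       (forall k, local_ring Z p (a k)) /\
       gen_eq Z (fun x => phi x ^+ r + \sum_(k < r) a k x * phi x ^+ k)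
                (fun=> 0)].

Definition proper_ideal (Z : set pt) (B m : set (pt -> F)) : Prop :=
  [/\ m `<=` B,
      forall phi, B phi -> gen_eq Z phi (fun=> 0) -> m phi,
      forall phi psi, m phi -> m psi -> m (fun x => phi x + psi x),
      forall a phi, B a -> m phi -> m (fun x => a x * phi x) &
      ~ m (fun=> 1)].

Definition maximal_ideal (Z : set pt) (B m : set (pt -> F)) : Prop :=
  proper_ideal Z B m /\
  forall m', proper_ideal Z B m' -> m `<=` m' -> m' = m.

(* The points of the normalization of a closed set X, i.e. of the disjoint union
   of the normalizations of its irreducible components Z. The points lying over
   p in Z are the maximal ideals of the integral closure of O_{Z,p}; all of them
   contract to the maximal ideal of O_{Z,p}, which is local. *)
Record normalization (X : set pt) : Type := NormalizationPoint {
  norm_comp : set pt;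
  norm_compP : irr_component X norm_comp;
  norm_map : pt;
  norm_mapP : norm_comp norm_map;
  norm_ideal : set (pt -> F);
  norm_idealP : maximal_ideal norm_comp
                  (integral_closure norm_comp norm_map) norm_ideal }.

End Zariski.

Section ClosedChain.
Variables (R : realType) (n : nat) (h : 'I_n -> dualquat R).

Definition config : set ('I_n -> P1 R) :=
  [set t | exists2 c : R, c != 0 & chain_prod h t = dq_const c].

Definition mobility_one : Prop := zdim config 1.

(* The real points, seen in (P^1_C)^n. *)
Definition complexify (t : 'I_n -> P1 R) : 'I_n -> P1 R[i] :=
  fun k => omap (real_complex R) (t k).

Definition configC : set ('I_n -> P1 R[i]) := zclosure (complexify @` config).

Definition bond_locus : set ('I_n -> P1 R[i]) :=
  [set t | configC t /\
           chain_prod (fun k => dq_map (real_complex R) (h k)) t = 0].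

Definition NC : Type := normalization configC.

Definition nu (beta : NC) : 'I_n -> P1 R[i] := norm_map beta.

Definition is_bond (beta : NC) : Prop := bond_locus (nu beta).

End ClosedChain.

(* Main.v *)
Require Import Defs.
From mathcomp Require Import all_boot all_order all_algebra.
From mathcomp Require Import reals complex ring.

(** A vanishing chain product has at least two singular factors, and the
    singular factors are those with [t^2 + 1 = 0].

    Since [h] has no scalar part, the quaternion conjugate of [t - s h] is
    [t + s h], and the norm of [t - s h] is the scalar [t^2 + s^2]
    ([joint_factor_conjr], [joint_factor_conjl]). A factor whose scalar
    [t^2 + s^2] is nonzero is therefore invertible. On the other hand no factor
    vanishes, because [h] is not a scalar ([joint_factor_neq0]). If at most one
    factor of a vanishing product were singular, cancelling the invertible ones
    on both sides would leave that factor equal to zero, or leave [1 = 0]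
    ([prod0_two_irregular]). Hence at least two factors are singular. *)

Set Implicit Arguments.
Unset Strict Implicit.
Unset Printing Implicit Defensive.

Import GRing.Theory.
Local Open Scope ring_scope.

(** Two singular factors must be found, not one: a single singular factor can be
    isolated by cancelling everything on its left and on its right. The
    recursion cancels on the left up to the first index where [z] holds. *)
Lemma prod0_two_irregular (A : nzRingType) (n : nat) (f : 'I_n -> A)
    (z : pred 'I_n) :
    (forall k, f k != 0) ->
    (forall k, ~~ z k -> GRing.lreg (f k) /\ GRing.rreg (f k)) ->
    \prod_(k < n) f k = 0 ->
  exists i j : 'I_n, [/\ (i < j)%N, z i & z j].
Proof.
elim: n f z => [|n IHn] f z f_neq0 f_reg.
  by rewrite big_ord0 => /eqP; rewrite oner_eq0.
rewrite big_ord_recl; have [z0|/f_reg[f0_reg _]] := boolP (z ord0).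
  have [/existsP[j zj] _|/existsPn nz] :=
    boolP [exists j : 'I_n, z (lift ord0 j)].
    by exists ord0, (lift ord0 j).
  have tail_reg : GRing.rreg (\prod_(k < n) f (lift ord0 k)).
    apply: (big_ind (@GRing.rreg A)) => [|x y|k _]; first exact: rreg1.
      exact: rregM.
    by have [] := f_reg _ (nz k).
  move=> /eqP; rewrite (mulIr_eq0 _ tail_reg) => f0.
  by have := f_neq0 ord0; rewrite f0.
move/eqP; rewrite (mulrI_eq0 _ f0_reg) => /eqP.
case/(IHn (fun k => f (lift ord0 k)) (fun k => z (lift ord0 k))).
- by move=> k; apply: f_neq0.
- by move=> k; apply: f_reg.
by move=> i [j [ltij zi zj]]; exists (lift ord0 i), (lift ord0 j).
Qed.

(** The cross terms [t * (- s h)] and [t * (s h)] cancel because [h] has no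
    scalar part and [t], [s] are central. *)
Lemma joint_factor_conjr (F : comNzRingType) (h : dualquat F) (x : P1 F) :
    revolute h ->
  joint_factor h x * quat_conj (joint_factor h x) = dq_const (sqr_add1 x).
Proof.
rewrite /joint_factor /sqr_add1 /dq_const; case: (hcoord x) => t s.
case: h => a b c d [/= -> hh].
have {hh} norm1 : b ^+ 2 + c ^+ 2 + d ^+ 2 = 1.
  by rewrite -[RHS](congr1 (@qre _) hh) /=; ring.
(* Without the casts the pairs would be multiplied componentwise. *)
have scalar_norm : (t ^+ 2 + s ^+ 2, 0) =
    ((t, 0) : dual F) ^+ 2 + ((s, 0) : dual F) ^+ 2 * (b ^+ 2 + c ^+ 2 + d ^+ 2).
  by rewrite norm1 mulr1 !expr2; congr pair => /=; ring.
rewrite /= {}scalar_norm.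
have -> : (0, 0) = 0 :> dual F by [].
by congr Quat => /=; ring.
Qed.

Lemma joint_factor_conjl (F : comNzRingType) (h : dualquat F) (x : P1 F) :
    revolute h ->
  quat_conj (joint_factor h x) * joint_factor h x = dq_const (sqr_add1 x).
Proof.
move=> h_rev; rewrite -(joint_factor_conjr x h_rev).
by case: (joint_factor h x) => a b c d; congr Quat => /=; ring.
Qed.

Lemma joint_factor_neq0 (F : comNzRingType) (h : dualquat F) (x : P1 F) :
  revolute h -> joint_factor h x != 0.
Proof.
case=> h0 hh; apply/eqP; case: x => [t|].
  rewrite /joint_factor /= mul1r => /subr0_eq th.
  have t0 : t = 0 by move: h0; rewrite -th => -[].
  by move: hh; rewrite -th t0 mul0r => /eqP; rewrite eq_sym oner_eq0.
rewrite /joint_factor /= mul0r subr0 => /eqP.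
by rewrite oner_eq0.
Qed.

Lemma joint_factor_regular (F : fieldType) (h : dualquat F) (x : P1 F) :
    revolute h -> sqr_add1 x != 0 ->
  GRing.lreg (joint_factor h x) /\ GRing.rreg (joint_factor h x).
Proof.
move=> h_rev x_neq0; set c := dq_const (sqr_add1 x)^-1.
have cV : c * dq_const (sqr_add1 x) = 1.
  by rewrite /c; congr Quat; congr pair => /=; rewrite ?mulVf //; ring.
have Vc : dq_const (sqr_add1 x) * c = 1.
  by rewrite /c; congr Quat; congr pair => /=; rewrite ?mulfV //; ring.
split=> y1 y2 /= eq_y.
  rewrite -[y1]mul1r -[y2]mul1r -cV -(joint_factor_conjl x h_rev).
  by rewrite -!mulrA eq_y.
rewrite -[y1]mulr1 -[y2]mulr1 -Vc -(joint_factor_conjr x h_rev).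
by rewrite !mulrA eq_y.
Qed.

(** The bond equation lives over [R[i]] while the joints are given over [R]; this
    carries the joints over to the complexified algebra. *)
Lemma revolute_map (F G : comNzRingType) (u : {rmorphism F -> G})
    (h : dualquat F) :
  revolute h -> revolute (dq_map u h).
Proof.
have mapM (x y : dualquat F) : dq_map u (x * y) = dq_map u x * dq_map u y.
  case: x y => [[? ?] [? ?] [? ?] [? ?]] [[? ?] [? ?] [? ?] [? ?]].
  by congr Quat; congr pair => /=; ring.
have map_conj (x : dualquat F) : dq_map u (quat_conj x) = quat_conj (dq_map u x).
  by case: x => [[? ?] [? ?] [? ?] [? ?]]; congr Quat; congr pair; apply: rmorphN.
case=> h0 hh; split; first by rewrite /= h0 /dual_map /= rmorph0.
rewrite -map_conj -mapM hh /dq_map /dual_map /=.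
by rewrite rmorph1 rmorph0.
Qed.

Theorem theorem10 (R : realType) (n : nat) (h : 'I_n -> dualquat R)
    (h_revolute : forall i, revolute (h i))
    (h_mobility : mobility_one h)
    (h_neq : forall i, h (ordS i) <> h i /\ h (ordS i) <> - h i)
    (beta : NC h) (h_bond : is_bond beta) :
  exists i j : 'I_n,
    [/\ (i < j)%N, sqr_add1 (nu beta i) = 0 & sqr_add1 (nu beta j) = 0].
Proof.
have hC_rev k : revolute (dq_map (real_complex R) (h k)).
  exact: revolute_map.
case: h_bond => _ prod0.
have [||i [j [ltij /eqP zi /eqP zj]]] :=
    @prod0_two_irregular _ _ _ (fun k => sqr_add1 (nu beta k) == 0) _ _ prod0.
- by move=> k; apply: joint_factor_neq0.
- by move=> k; apply: joint_factor_regular.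
by exists i, j.
Qed.
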